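(* For all positive real numbers $a,b,k$ and all $x>0$, $$J^aJ^b(x^k)=J^{a+b}(x^k)=J^bJ^a(x^k)=\frac{\Gamma(k+1)}{\Gamma(a+b+k+1)}\,x^{a+b+k}.$$
   Context: For a real number $s>0$, the $s$-order integral operator $J^s$ is defined by $$J^s(f)(x)=\frac{1}{\Gamma(s)}\int_0^x (x-y)^{s-1}f(y)\,dy,\qquad x>0,$$ where $\Gamma$ is Euler's gamma function. $J^s(x^k)$ denotes $J^s(f)(x)$ for the function $f(x)=x^k$, and $J^aJ^b$ denotes the composition of operators. *)

(* Defs.v *)
From HB Require Import structures.
From mathcomp Require Export all_boot all_order all_algebra.
From mathcomp Require Export all_classical all_reals all_analysis.

Set Implicit Arguments.
Unset Strict Implicit.
Unset Printing Implicit Defensive.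

Import Order.TTheory GRing.Theory Num.Theory.
Import numFieldNormedType.Exports.

Local Open Scope classical_set_scope.
Local Open Scope ring_scope.

(* Euler's integral; it converges for [0 < s], the only case in which the
   value is meaningful. *)
Definition Gamma (R : realType) (s : R) : R :=
  \int[lebesgue_measure]_(t in `]0, +oo[) (t `^ (s - 1) * expR (- t)).

(* The interval is open so that [f] is only used at points [y > 0] and the
   base [x - y] of the power is never [0]. *)
Definition J (R : realType) (s : R) (f : R -> R) (x : R) : R :=
  (Gamma s)^-1 *
  \int[lebesgue_measure]_(y in `]0, x[) ((x - y) `^ (s - 1) * f y).

(* Main.v *)
Require Import Defs.
From mathcomp Require Import all_boot all_order all_algebra.
From mathcomp Require Import all_classical all_reals all_analysis.
From mathcomp Require Import measurable_realfun ring.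

(** Everything follows from [J^s(x^k) = Γ(k+1)/Γ(s+k+1) x^(s+k)], applied
    twice for the composition.  With [g_s(t) = t^(s-1)] for [t > 0] and [0] otherwise,
    the integral defining [J^s] is the convolution [g_s * g_(k+1)], which by
    scaling equals [g_(s+k+1)] times its value at [1].  Integrating it against
    [exp(-x)] and exchanging the integrals by Tonelli gives
    [Γ(s) Γ(p) = Γ(s+p) (g_s * g_p)(1)].  Tonelli holds in [[0, +oo]], so the
    only analytic input left is [0 < Γ(s) < +oo] for [s > 0]. *)

Set Implicit Arguments.
Unset Strict Implicit.
Unset Printing Implicit Defensive.

Import Order.TTheory GRing.Theory Num.Theory.
Import numFieldNormedType.Exports.

Local Open Scope classical_set_scope.
Local Open Scope ring_scope.

(** * Affine change of variables for Lebesgue measure *)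

Section affine.
Context {R : realType}.
Local Notation mu := (@lebesgue_measure R).

Let measurable_affine (c d : R) :
  measurable_fun [set: R] (fun x : R => c * x + d).
Proof. by apply: measurable_funD => //; exact: measurable_funM. Qed.

(** By uniqueness of Lebesgue measure: the pushforward under the affine map, scaled by [c], gives
    each half-open interval its length. *)
Lemma lebesgue_measure_affine (c d : R) (A : set R) : 0 < c -> measurable A ->
  (c%:E * mu ((fun x => c * x + d)%R @^-1` A))%E = mu A.
Proof.
move=> c0 mA.
pose phi := fun x : measurableTypeR R => (c * x + d)%R : measurableTypeR R.
have mphi : measurable_fun setT phi by exact: measurable_affine.
pose m := mscale (NngNum (ltW c0)) (pushforward mu phi).
have <- : m mphi A = (c%:E * mu (phi @^-1` A))%E by [].
apply/esym/(lebesgue_measure_unique (mu := m mphi)) => // _ [[u v]] _ <- /=.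
rewrite /m /mscale /= /pushforward.
rewrite (_ : phi @^-1` _ = `](u - d) / c, (v - d) / c]%classic); last first.
  apply/seteqP; split => y /=; rewrite !in_itv/= /phi;
  by rewrite ltr_pdivrMr// ler_pdivlMr// ltrBlDr lerBrDr (mulrC y).
rewrite !lebesgue_measure_itv/= !lte_fin.
rewrite ltr_pM2r ?invr_gt0// ltrD2r; case: ifPn => _; last by rewrite mule0.
by rewrite -!EFinD -EFinM; congr EFin; field; rewrite gt_eqF.
Qed.

(** The integral on the right is one against the pushforward of [mu]. Only measurability and sign
    are asked of [f], so both sides may be infinite. *)
Lemma ge0_integral_affine (c d : R) (f : R -> \bar R) : 0 < c ->
  measurable_fun [set: R] f -> (forall x, 0 <= f x)%E ->
  (\int[mu]_x f x = c%:E * \int[mu]_x f (c * x + d)%R)%E.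
Proof.
move=> c0 mf f0.
pose phi := fun x : measurableTypeR R => (c * x + d)%R : measurableTypeR R.
have mphi : measurable_fun setT phi by exact: measurable_affine.
have -> : (\int[mu]_x f (c * x + d)%R)%E = (\int[pushforward mu phi]_x f x)%E.
  by rewrite ge0_integral_pushforward//=.
rewrite -[c]/((NngNum (ltW c0))%:num) -ge0_integral_mscale//.
by apply: eq_measure_integral => A mA _; exact/esym/lebesgue_measure_affine.
Qed.

End affine.

(** * Convolution of truncated powers and the Gamma-Beta relation *)

Section gamma_convolution.
Context {R : realType}.
Local Notation mu := (@lebesgue_measure R).
Implicit Types s p t x y c : R.

(** Truncation lets every integral run over the whole line, where shifts and scalings leave the
    domain unchanged. *)
Definition pospow s : R -> R := (fun t => t `^ (s - 1)) \_ `]0, +oo[.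

Lemma gt0_pospow s t : 0 < t -> pospow s t = t `^ (s - 1).
Proof. by move=> t0; rewrite /pospow patchE mem_set//= in_itv/= t0. Qed.

Lemma le0_pospow s t : t <= 0 -> pospow s t = 0.
Proof.
by move=> t0; rewrite /pospow patchE memNset//= in_itv/= andbT ltNge t0.
Qed.

Lemma pospow_ge0 s t : 0 <= pospow s t.
Proof.
case: (leP t 0) => t0; first by rewrite le0_pospow.
by rewrite gt0_pospow// powR_ge0.
Qed.

Lemma measurable_pospow s : measurable_fun [set: R] (pospow s).
Proof.
apply/(measurable_restrictT _ _).1 => //.
by apply: measurable_funTS; exact: measurable_powR.
Qed.

Lemma pospowM s c t : 0 < c -> pospow s (c * t) = c `^ (s - 1) * pospow s t.
Proof.
move=> c0; case: (leP t 0) => t0.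
  by rewrite !le0_pospow ?mulr0// pmulr_rle0.
by rewrite !gt0_pospow ?mulr_gt0// powRM ?ltW.
Qed.

(** Valued in [\bar R], so that identities need no convergence hypothesis; [EFin_Gamma] links it to
    [Gamma] for [0 < s]. *)
Definition eGamma s : \bar R := (\int[mu]_t (pospow s t * expR (- t))%:E)%E.

(** At [x = 1] this is Euler's Beta integral. *)
Definition conv_pospow s p x : \bar R :=
  (\int[mu]_y (pospow s (x - y) * pospow p y)%:E)%E.

Lemma measurable_expRN : measurable_fun [set: R] (fun t : R => expR (- t)).
Proof. exact: measurableT_comp. Qed.

Lemma eGamma_ge0 s : (0 <= eGamma s)%E.
Proof.
by apply: integral_ge0 => t _; rewrite lee_fin mulr_ge0 ?pospow_ge0 ?expR_ge0.
Qed.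

Lemma conv_pospow_ge0 s p x : (0 <= conv_pospow s p x)%E.
Proof. by apply: integral_ge0 => t _; rewrite lee_fin mulr_ge0 ?pospow_ge0. Qed.

Lemma measurable_conv_pospow s p x :
  measurable_fun [set: R] (fun y => pospow s (x - y) * pospow p y).
Proof.
apply: measurable_funM; last exact: measurable_pospow.
apply: measurableT_comp; first exact: measurable_pospow.
exact: measurable_funB.
Qed.

(** Substituting [x * y] for [y] makes both factors homogeneous in [x]. *)
Lemma conv_pospowE s p x :
  conv_pospow s p x = ((pospow (s + p) x)%:E * conv_pospow s p 1)%E.
Proof.
case: (leP x 0) => x0.
  (* For [x <= 0], at every [y] one of [y] and [x - y] is nonpositive, so the integrand vanishes. *)
  rewrite le0_pospow// mul0e /conv_pospow integral0_eq// => y _.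
  case: (leP y 0) => y0; first by rewrite (le0_pospow p)// mulr0.
  by rewrite le0_pospow ?mul0r// subr_le0 (le_trans x0)// ltW.
rewrite /conv_pospow (@ge0_integral_affine _ x 0)//; first last.
- by move=> y; rewrite lee_fin mulr_ge0// pospow_ge0.
- by apply/measurable_EFinP; exact: measurable_conv_pospow.
have scale y : pospow s (x - (x * y + 0)) * pospow p (x * y + 0) =
    x `^ (s - 1) * x `^ (p - 1) * (pospow s (1 - y) * pospow p y).
  rewrite addr0 (_ : x - x * y = x * (1 - y)); last by ring.
  by rewrite !pospowM//; ring.
under eq_integral do rewrite scale EFinM.
rewrite ge0_integralZl_EFin//; first last.
- by rewrite mulr_ge0// powR_ge0.
- by apply/measurable_EFinP; exact: measurable_conv_pospow.
- by move=> y _; rewrite lee_fin mulr_ge0// pospow_ge0.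
rewrite muleA -EFinM gt0_pospow//; congr (_%:E * _)%E.
rewrite -powRD; last by rewrite (gt_eqF x0) implybT.
(* The Jacobian [x] supplies the missing unit in the exponent:
   [1 + (s - 1) + (p - 1) = s + p - 1]. *)
rewrite -{1}(@powRr1 _ x) ?ltW// -powRD; last by rewrite (gt_eqF x0) implybT.
by congr (_ `^ _); ring.
Qed.

(* Tonelli on [g s (x - y) * g p y * exp (- x)], with [g := pospow]. *)
Lemma eGammaM s p :
  (eGamma s * eGamma p = eGamma (s + p) * conv_pospow s p 1)%E.
Proof.
pose f (z : measurableTypeR R * measurableTypeR R) : \bar R :=
  (pospow s (z.2 - z.1) * pospow p z.1 * expR (- z.2))%:E.
have mf : measurable_fun setT f.
  apply/measurable_EFinP; apply: measurable_funM.
    apply: measurable_funM.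
      apply: measurableT_comp; first exact: measurable_pospow.
      exact: measurable_funB.
    by apply: measurableT_comp; first exact: measurable_pospow.
  exact: (measurableT_comp measurable_expRN measurable_snd).
have f0 z : (0 <= f z)%E by rewrite lee_fin !mulr_ge0 ?pospow_ge0 ?expR_ge0.
have := @fubini_tonelli _ _ _ _ _ mu mu _ mf f0.
have -> : (\int[mu]_y \int[mu]_x f (y, x) = eGamma s * eGamma p)%E.
  rewrite /eGamma -ge0_integralZl//; first last.
  - exact: eGamma_ge0.
  - by move=> y _; rewrite lee_fin mulr_ge0 ?pospow_ge0 ?expR_ge0.
  - apply/measurable_EFinP.
    apply: measurable_funM; first exact: measurable_pospow.
    exact: measurable_expRN.
  apply: eq_integral => y _.
  (* For fixed [y], the shift [x = t + y] separates the variables, since [exp (- x)] splits as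
     [exp (- t) * exp (- y)]. *)
  rewrite (@ge0_integral_affine _ 1 y)//; first last.
  - exact: measurableT_comp mf _.
  rewrite mul1e muleC -ge0_integralZl//; first last.
  - by rewrite lee_fin mulr_ge0 ?pospow_ge0 ?expR_ge0.
  - by move=> t _; rewrite lee_fin mulr_ge0 ?pospow_ge0 ?expR_ge0.
  - apply/measurable_EFinP.
    apply: measurable_funM; first exact: measurable_pospow.
    exact: measurable_expRN.
  apply: eq_integral => t _.
  rewrite /f /= -EFinM mul1r addrK opprD expRD.
  by congr EFin; ring.
move=> ->.
(* In the other order, the inner integral is [exp (- x)] times the convolution at [x], to which the
   scaling law applies. *)
rewrite muleC /eGamma -ge0_integralZl//; first last.
- exact: conv_pospow_ge0.
- by move=> y _; rewrite lee_fin mulr_ge0 ?pospow_ge0 ?expR_ge0.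
- apply/measurable_EFinP.
  apply: measurable_funM; first exact: measurable_pospow.
  exact: measurable_expRN.
apply: eq_integral => x _; rewrite /f /=.
under eq_integral do rewrite mulrC EFinM.
rewrite ge0_integralZl//; first last.
- by move=> y _; rewrite lee_fin mulr_ge0// pospow_ge0.
- by apply/measurable_EFinP; exact: measurable_conv_pospow.
rewrite -/(conv_pospow s p x) conv_pospowE muleA EFinM muleC.
by rewrite (muleC (expR _)%:E).
Qed.

End gamma_convolution.

(** * Convergence of Euler's integral *)

Section gamma_finite.
Context {R : realType}.
Local Notation mu := (@lebesgue_measure R).
Implicit Types s p t : R.

(* [1 + t <= r (1 + t / r) <= r exp (t / r)] for [r >= 1] *)
Lemma powR_1D_le_expR (r t : R) : 1 <= r -> 0 <= t ->
  (1 + t) `^ r <= r `^ r * expR t.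
Proof.
move=> r1 t0; have r0 : 0 < r by rewrite (lt_le_trans _ r1).
have le1 : 1 + t <= r * expR (t / r).
  have : r * (1 + t / r) <= r * expR (t / r).
    by rewrite ler_pM2l// expR_ge1Dx.
  by apply: le_trans; rewrite mulrDr mulr1 mulrCA divff ?gt_eqF// mulr1 lerD2r.
have -> : expR t = expR (t / r) `^ r.
  by rewrite -expRM divfK// gt_eqF.
rewrite -powRM ?expR_ge0 ?(ltW r0)//.
apply: ge0_ler_powR; rewrite ?(ltW r0)// nnegrE ?addr_ge0//.
by rewrite mulr_ge0 ?expR_ge0// ltW.
Qed.

Lemma measurable_gamma_integrand s (D : set R) :
  measurable_fun D (fun t => (t `^ (s - 1) * expR (- t))%:E).
Proof.
apply/measurable_EFinP; apply: measurable_funTS.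
apply: measurable_funM; first exact: measurable_powR.
exact: measurableT_comp.
Qed.

(* Integrable majorant: [F'] is [f = t^(s-1) (1+t)^(-s-1)], and [F] tends to
   [s^-1] at infinity. *)
Let F s t : R := (1 + t^-1) `^ (- s) / s.
Let f s t : R := (1 + t^-1) `^ (- s - 1) * t ^- 2.

Let add1V_gt0 t : 0 < t -> 0 < 1 + t^-1.
Proof. by move=> t0; rewrite addr_gt0// invr_gt0. Qed.

Let is_derive_1DV t : 0 < t ->
  is_derive t 1 (fun u : R => 1 + u^-1) (- t ^- 2).
Proof.
move=> t0.
have h : is_derive t (1 : R) (fun u : R => u^-1) (- t ^- 2).
  have := @is_deriveV _ id t 1 1 _ _.
  by rewrite /= -[_ *: 1]/(_ * 1) mulr1; apply; rewrite gt_eqF.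
rewrite -[X in is_derive _ _ _ X]add0r.
exact: (is_deriveD (is_derive_cst (1 : R) t 1) h).
Qed.

Let is_derive_powR_1DV p t : 0 < t ->
  is_derive t 1 (fun u : R => (1 + u^-1) `^ p)
    (p * (1 + t^-1) `^ (p - 1) * - t ^- 2).
Proof.
move=> t0.
exact: (is_derive1_comp (g := fun u : R => 1 + u^-1)
  (is_derive1_powR p (add1V_gt0 t0)) (is_derive_1DV t0)).
Qed.

Let is_derive_F s t : 0 < s -> 0 < t -> is_derive t 1 (F s) (f s t).
Proof.
move=> s0 t0.
have := @is_deriveM _ _ (fun u : R => (1 + u^-1) `^ (- s)) (cst (s^-1 : R))
  t 1 _ 0 (is_derive_powR_1DV (- s) t0) _.
move=> /(_ (is_derive_cst _ _ _)).
congr is_derive; rewrite /f /= scaler0 add0r -[_ *: _]/(_ * _).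
by field; rewrite !gt_eqF.
Qed.

Let continuous_f s t : 0 < t -> {for t, continuous (f s)}.
Proof.
move=> t0.
have c1 : {for t, continuous (fun u : R => (1 + u^-1) `^ (- s - 1))}.
  apply: differentiable_continuous; apply/derivable1_diffP.
  by have [] := is_derive_powR_1DV (- s - 1) t0.
have c2 : {for t, continuous (fun u : R => u ^- 2)}.
  by apply: cvgV; [rewrite expf_eq0 gt_eqF|exact: exprn_continuous].
exact: cvgM c1 c2.
Qed.

Let within_continuous_f s (e : R) : 0 < e ->
  {within `[e, +oo[, continuous (f s)}.
Proof.
move=> e0; apply: continuous_in_subspaceT => t.
rewrite inE/= in_itv/= andbT => et.
by apply: continuous_f; rewrite (lt_le_trans e0).
Qed.

Let cvg_F s : F s t @[t --> +oo] --> s^-1.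
Proof.
have c1 : (fun t : R => 1 + t^-1) t @[t --> +oo] --> (1 : R).
  rewrite -[X in _ --> X]addr0; apply: cvgD; first exact: cvg_cst.
  by apply/gtr0_cvgV0; [exact: nbhs_pinfty_gt|exact: cvg_id].
have c2 : {for (1 : R), continuous (fun u : R => u `^ (- s))}.
  apply: differentiable_continuous; apply/derivable1_diffP.
  by apply: derivable_powR; rewrite in_itv/= ltr01.
have c3 : ((1 + t^-1) `^ (- s)) @[t --> +oo] --> (1 : R) `^ (- s).
  exact: cvg_comp c1 c2.
rewrite -[X in _ --> X]mul1r -(congr1 (@^~ (- s)) (powR1 R)).
exact: cvgM c3 (cvg_cst _).
Qed.

(** The integral equals [s^-1 - F s e] with [F s e >= 0]. The bound is uniform in [e], which allows
    [e] to tend to [0]. *)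
Let integral_f s e : 0 < s -> 0 < e ->
  (\int[mu]_(t in `[e, +oo[) (f s t)%:E <= s^-1%:E)%E.
Proof.
move=> s0 e0; rewrite (@ge0_continuous_FTC2y _ _ (F s) e s^-1).
- by rewrite -EFinD lee_fin lerBlDr lerDl divr_ge0 ?powR_ge0 ?ltW//.
- move=> t et; rewrite mulr_ge0 ?powR_ge0//.
  by rewrite invr_ge0 exprn_ge0// (le_trans _ et)// ltW.
- exact: within_continuous_f.
- exact: cvg_F.
- by move=> t et; have [] := is_derive_F s0 (lt_trans e0 et).
- apply: cvg_at_right_filter; suff : {for e, continuous (F s)} by [].
  apply: differentiable_continuous; apply/derivable1_diffP.
  by have [] := is_derive_F s0 e0.
- move=> t; rewrite in_itv/= andbT => et.
  by rewrite derive1E; have [_ ->] := is_derive_F s0 (lt_trans e0 et).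
Qed.

(** After cancelling [t^(s-1)], this is [powR_1D_le_expR] at [r = s + 1]. *)
Let gamma_integrand_le s t : 0 < s -> 0 < t ->
  t `^ (s - 1) * expR (- t) <= (s + 1) `^ (s + 1) * f s t.
Proof.
move=> s0 t0.
have t1 : 0 < 1 + t by rewrite addr_gt0.
have -> : f s t = t `^ (s - 1) * (1 + t) `^ (- (s + 1)).
  rewrite /f (_ : 1 + t^-1 = (1 + t) * t^-1); last by field; rewrite gt_eqF.
  rewrite powRM ?invr_ge0 ?(ltW t0) ?(ltW t1)// -(powR_inv1 (ltW t0)) -powRrM.
  rewrite -mulrA -(powR_invn _ (ltW t0)) -powRD; last first.
    by rewrite (gt_eqF t0) implybT.
  by rewrite mulrC; congr (_ `^ _ * _ `^ _); ring.
rewrite mulrCA ler_pM2l ?powR_gt0// powRN expRN.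
rewrite ler_pdivlMr ?powR_gt0// mulrC ler_pdivrMr ?expR_gt0//.
by apply: powR_1D_le_expR; [rewrite lerDr ltW|exact: ltW].
Qed.

(** The majorant is integrated on closed half-lines away from [0]; monotone convergence along
    [[1/(n+1), +oo[] then carries the uniform bound to []0, +oo[]. *)
Lemma gamma_integral_lty s : 0 < s ->
  (\int[mu]_(t in `]0%R, +oo[) (t `^ (s - 1) * expR (- t))%:E < +oo)%E.
Proof.
move=> s0.
pose g t := (t `^ (s - 1) * expR (- t))%:E.
have mg (D : set R) : measurable_fun D g by exact: measurable_gamma_integrand.
have g0 t : (0 <= g t)%E by rewrite lee_fin mulr_ge0 ?powR_ge0 ?expR_ge0.
pose A n : set R := `[n.+1%:R^-1, +oo[%classic.
have <- : \bigcup_n A n = `]0, +oo[%classic.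
  apply/seteqP; split=> [t [n _]|t]; rewrite /A/= !in_itv/= !andbT.
    by move=> nt; rewrite (lt_le_trans _ nt)// invr_gt0 ltr0n.
  move=> t0; have tV0 : 0 < t^-1 by rewrite invr_gt0.
  (* An integer above [1/t], so that [1/(n+1) <= t]. *)
  exists (Num.bound t^-1) => //; rewrite /A/= in_itv/= andbT.
  rewrite -[leRHS]invrK lef_pV2 ?posrE ?ltr0n// -natr1.
  by rewrite (le_trans (ltW (archi_boundP (ltW tV0))))// lerDl.
have mA n : measurable (A n) by exact: measurable_itv.
have ndA : nondecreasing_seq A.
  move=> m n mn; apply/subsetPset => t; rewrite /A/= !in_itv/= !andbT.
  by move=> mt; rewrite (le_trans _ mt)// lef_pV2 ?posrE ?ltr0n// ler_nat ltnS.
have cA : (\int[mu]_(t in A n) g t @[n --> \oo] -->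
    \int[mu]_(t in \bigcup_n A n) g t)%E.
  apply: ge0_nondecreasing_set_cvg_integral => // n.
  exact: (mg (A n)).
apply: (@le_lt_trans _ _ ((s + 1) `^ (s + 1) * s^-1)%:E); last exact: ltry.
rewrite -(cvg_lim _ cA)//; apply: lime_le.
  by apply/cvg_ex; eexists; exact: cA.
apply: nearW => n.
have n0 : 0 < n.+1%:R^-1 :> R by rewrite invr_gt0 ltr0n.
have mf : measurable_fun (A n) (fun t => (f s t)%:E).
  apply/measurable_EFinP; apply: subspace_continuous_measurable_fun => //.
  exact: within_continuous_f.
have f0 t : A n t -> 0 <= f s t.
  rewrite /A/= in_itv/= andbT => et.
  by rewrite mulr_ge0 ?powR_ge0// invr_ge0 exprn_ge0// (le_trans _ et)// ltW.
apply: (@le_trans _ _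
    (\int[mu]_(t in A n) (((s + 1) `^ (s + 1))%:E * (f s t)%:E))%E).
  apply: ge0_le_integral => //.
  - exact: mA.
  - exact: (mg (A n)).
  - exact: measurable_funeM.
  - move=> t; rewrite /A/= in_itv/= andbT => et.
    by rewrite -EFinM lee_fin gamma_integrand_le// (lt_le_trans n0).
rewrite ge0_integralZl_EFin ?powR_ge0//; last exact: mA.
by rewrite EFinM lee_pmul2l ?lte_fin ?powR_gt0 ?addr_gt0// integral_f.
Qed.

End gamma_finite.

(** * Fractional integrals of powers and their composition *)

Section fractional_integral.
Context {R : realType}.
Local Notation mu := (@lebesgue_measure R).
Implicit Types a b c k s p t x y : R.

Lemma eGammaE s :
  eGamma s = (\int[mu]_(t in `]0%R, +oo[) (t `^ (s - 1) * expR (- t))%:E)%E.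
Proof.
rewrite [RHS]integral_mkcond; apply: eq_integral => t _.
rewrite patchE /pospow patchE; case: ifPn => // _.
by rewrite mul0r.
Qed.

Lemma conv_pospow_itv s p x : conv_pospow s p x =
  (\int[mu]_(y in `]0%R, x[) ((x - y) `^ (s - 1) * y `^ (p - 1))%:E)%E.
Proof.
rewrite [RHS]integral_mkcond; apply: eq_integral => y _.
rewrite patchE mem_setE in_itv/=; case: (ltP 0 y) => y0 /=; last first.
  by rewrite (le0_pospow p)// mulr0.
rewrite (gt0_pospow p)//; case: (ltP y x) => yx.
  by rewrite gt0_pospow// subr_gt0.
by rewrite le0_pospow ?mul0r// subr_le0.
Qed.

Lemma eGamma_fin_num s : 0 < s -> eGamma s \is a fin_num.
Proof.
move=> s0; rewrite ge0_fin_numE ?eGamma_ge0// eGammaE.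
exact: gamma_integral_lty.
Qed.

(** The real-valued integral sends an infinite value to [0]; finiteness of [eGamma s] rules this
    case out. *)
Lemma EFin_Gamma s : 0 < s -> (Gamma s)%:E = eGamma s.
Proof. by move=> s0; rewrite -(fineK (eGamma_fin_num s0)) eGammaE. Qed.

(** On [[1, 2]] the integrand is at least [2^-1 * exp (- 2)], because [t^(s-1) = t^s / t] with
    [t^s >= 1] and [1/t >= 1/2]. *)
Lemma Gamma_gt0 s : 0 < s -> 0 < Gamma s.
Proof.
move=> s0; rewrite -lte_fin EFin_Gamma// eGammaE.
apply: (@lt_le_trans _ _
  (\int[mu]_(t in `[1%R, 2%R]) (2^-1 * expR (- 2))%:E)%E).
  rewrite integral_cst//= lebesgue_measure_itv/= lte_fin ltr1n.
  by rewrite -EFinD -EFinM lte_fin !mulr_gt0 ?expR_gt0// subr_gt0 ltr1n.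
apply: (@le_trans _ _
  (\int[mu]_(t in `[1%R, 2%R]) (t `^ (s - 1) * expR (- t))%:E)%E).
  apply: ge0_le_integral => //.
  - exact: measurable_gamma_integrand.
  move=> t; rewrite /= in_itv/= => /andP[t1 t2].
  have t0 : 0 < t by rewrite (lt_le_trans _ t1).
  rewrite lee_fin ler_pM ?expR_ge0// ?ler_expR ?lerN2//.
  rewrite powRB ?(gt_eqF t0) ?implybT// powRr1 ?(ltW t0)//.
  rewrite -[leLHS]mul1r ler_pM ?invr_ge0//.
    by rewrite -(powRr0 t) ler_powR// ltW.
  by rewrite lef_pV2 ?posrE.
apply: ge0_subset_integral => //.
- exact: measurable_gamma_integrand.
- by move=> t _; rewrite lee_fin mulr_ge0 ?powR_ge0 ?expR_ge0.
- move=> t /=; rewrite !in_itv/= andbT => /andP[t1 _].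
  by rewrite (lt_le_trans _ t1).
Qed.

Lemma conv_pospow_Gamma s p x : 0 < s -> 0 < p -> 0 < x ->
  conv_pospow s p x =
  (Gamma s * Gamma p / Gamma (s + p) * x `^ (s + p - 1))%:E.
Proof.
move=> s0 p0 x0; have sp0 : 0 < s + p by rewrite addr_gt0.
have := eGammaM s p; rewrite -!EFin_Gamma// => H.
have c1 : conv_pospow s p 1 = (Gamma s * Gamma p / Gamma (s + p))%:E.
  rewrite EFinM EFinM H muleAC -EFinM divff ?mul1e// gt_eqF//.
  exact: Gamma_gt0.
by rewrite conv_pospowE c1 gt0_pospow// -EFinM mulrC.
Qed.

(** The integral is the convolution at [p = k + 1], whose factor [Gamma s] cancels the
    normalisation. The constant [c] is carried along for the outer operator of a composition. *)
Lemma J_scale_powR s k c x : 0 < s -> 0 < k + 1 -> 0 <= c -> 0 < x ->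
  J s (fun y => c * y `^ k) x =
  c * (Gamma (k + 1) / Gamma (s + k + 1)) * x `^ (s + k).
Proof.
move=> s0 k0 c0 x0; rewrite /J /Rintegral.
under eq_integral do rewrite mulrCA EFinM.
rewrite ge0_integralZl_EFin//; first last.
- apply/measurable_EFinP; apply: measurable_funTS; apply: measurable_funM.
    apply: (measurableT_comp (measurable_powR _)).
    exact: measurable_funB.
  exact: measurable_powR.
- by move=> y _; rewrite lee_fin mulr_ge0 ?powR_ge0.
have := conv_pospow_Gamma s0 k0 x0; rewrite conv_pospow_itv addrK => ->.
rewrite -EFinM /= addrA addrK.
have Gs := Gamma_gt0 s0.
have Gsk : 0 < Gamma (s + k + 1) by apply: Gamma_gt0; rewrite -addrA addr_gt0.
by field; rewrite !gt_eqF.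
Qed.

Lemma J_powR s k x : 0 < s -> 0 < k + 1 -> 0 < x ->
  J s (fun y => y `^ k) x =
  Gamma (k + 1) / Gamma (s + k + 1) * x `^ (s + k).
Proof.
move=> s0 k0 x0; rewrite -[in RHS](mul1r (_ / _)) -J_scale_powR//.
by congr J; apply/funext => y; rewrite mul1r.
Qed.

(** Needed because [J_powR] gives the inner integral only at positive points. *)
Lemma eq_J s (f g : R -> R) x :
  (forall y, 0 < y < x -> f y = g y) -> J s f x = J s g x.
Proof.
move=> fg; rewrite /J; congr (_ * _); apply: eq_Rintegral => y.
by rewrite inE/= in_itv/= => /fg ->.
Qed.

Lemma J_J_powR a b k x : 0 < a -> 0 < b -> 0 < k + 1 -> 0 < x ->
  (J a \o J b) (fun y => y `^ k) x =
  Gamma (k + 1) / Gamma (a + b + k + 1) * x `^ (a + b + k).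
Proof.
move=> a0 b0 k0 x0 /=.
have bk0 : 0 < b + k + 1 by rewrite -addrA addr_gt0.
have abk0 : 0 < a + (b + k) + 1 by rewrite -addrA addr_gt0.
have G1 := Gamma_gt0 k0; have G2 := Gamma_gt0 bk0; have G3 := Gamma_gt0 abk0.
(* The outer operator contributes [Gamma (b + k + 1)] in the numerator, which cancels the inner
   denominator. *)
rewrite (@eq_J _ _ (fun y => Gamma (k + 1) / Gamma (b + k + 1) * y `^ (b + k))).
  rewrite J_scale_powR// ?divr_ge0 ?ltW// -[a + b + k]addrA.
  by congr (_ * _); field; rewrite !gt_eqF.
by move=> y /andP[y0 _]; rewrite J_powR.
Qed.

End fractional_integral.

Theorem theorem6 (R : realType) (a b k x : R)
    (ha : 0 < a) (hb : 0 < b) (hk : 0 < k) (hx : 0 < x) :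
  [/\ (J a \o J b) (fun y : R => y `^ k) x = J (a + b) (fun y : R => y `^ k) x,
      J (a + b) (fun y : R => y `^ k) x = (J b \o J a) (fun y : R => y `^ k) x
    & (J b \o J a) (fun y : R => y `^ k) x
      = Gamma (k + 1) / Gamma (a + b + k + 1) * x `^ (a + b + k)].
Proof.
have k10 : 0 < k + 1 by rewrite addr_gt0.
(* The closed form depends on [a] and [b] only through their sum, hence the commutation. *)
by rewrite !J_J_powR// J_powR ?addr_gt0// (addrC b a).
Qed.
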